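(* Let $p\in\mathbb{N}$ (a positive integer), let $\psi_p$ denote the $p$-analogue of the digamma function and $\gamma$ the Euler–Mascheroni constant. The function $$q_p(t) := t^{\,t\left(\psi_p(t)-\log\frac{pt}{t+p+1}\right)-\gamma}$$ is logarithmically completely monotonic on $(0,1)$.
   Context: For $p\in\mathbb{N}$ and $x>0$, the $p$-analogue of the gamma function is $$\Gamma_p(x)=\frac{p!\,p^x}{x(x+1)\cdots(x+p)},$$ and the $p$-analogue of the digamma function is its logarithmic derivative $\psi_p(x)=\frac{d}{dx}\ln\Gamma_p(x)=\Gamma_p'(x)/\Gamma_p(x)$; equivalently $\psi_p(x)=\ln p-\sum_{k=0}^{p}\frac{1}{x+k}$. The symbol $\gamma$ denotes the Euler–Mascheroni constant, and $\log=\ln$ is the natural logarithm. A positive function $f$ on an open interval $I$ is called logarithmically completely monotonic on $I$ if (it has derivatives of all orders on $I$ and) $(-1)^n[\ln f(x)]^{(n)}\ge 0$ for all $x\in I$ and all $n=1,2,\ldots$. *)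

(* Defs.v *)
(* Stdlib reals with Coquelicot. *)
From Stdlib Require Import Factorial Reals.
From Coquelicot Require Import Coquelicot.
Open Scope R_scope.

(* [prod_f_R0 f p] is the product of the p+1 factors f 0, ..., f p. *)
Definition p_gamma (p : nat) (x : R) : R :=
  INR (fact p) * Rpower (INR p) x / prod_f_R0 (fun k => x + INR k) p.

Definition p_digamma (p : nat) (x : R) : R :=
  Derive (fun y => ln (p_gamma p y)) x.

(* The value at n = 0 (where [ln 0] is a junk value) does not affect the
   limit, which is finite. *)
Definition euler_mascheroni : R :=
  real (Lim_seq (fun n => sum_n_m (fun k => / INR k) 1 n - ln (INR n))).

(* Endpoints in [Rbar], so that (a, b) is an arbitrary open interval.
   [ex_derive_n f n x] only says that the total function [Derive_n f (n-1)] is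
   differentiable at x; required for all n and all x in the open interval, it
   says that f has derivatives of all orders there. *)
Definition log_completely_monotonic_on (a b : Rbar) (f : R -> R) : Prop :=
  forall x : R, Rbar_lt a x -> Rbar_lt x b ->
    0 < f x /\
    (forall n : nat, ex_derive_n f n x) /\
    (forall n : nat, (1 <= n)%nat ->
       0 <= (-1) ^ n * Derive_n (fun t => ln (f t)) n x).

(* [Rpower t y] is [exp (y * ln t)], i.e. t^y for t > 0. *)
Definition q_fun (p : nat) (t : R) : R :=
  Rpower t (t * (p_digamma p t - ln (INR p * t / (t + INR p + 1)))
            - euler_mascheroni).

(* Main.v *)
(* With m = p + 1 put f(t) = sum_(k<m) 1/(t+k) - ln ((t+m)/t) and g(t) = t f(t).
   On (0,1) one has ln q_p(t) = (gamma + g(t)) (- ln t). Both gamma >= 0 and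
   - ln t have derivatives alternating in sign, and such functions are closed
   under sums, products and exponentials, so it suffices that g is completely
   monotonic on (0,oo).

   For n >= 2, (-1)^n g^(n)(t) is the Laplace integral over s > 0 of
     s^(n-2) e^(-ts) (1 - (1 + m s) e^(-ms) - s^2 sum_(k<m) k e^(-ks)),
   whose last factor is nonnegative because s^2 e^(-s) <= (1 - e^(-s))^2.
   Improper integrals are avoided by working with explicit antiderivatives
   vanishing at infinity. The case n = 1 follows as g' is nondecreasing with
   limit 0, and n = 0 from ln (1 + 1/x) <= 1/x. *)
Require Import Defs.
From Stdlib Require Import Factorial Reals Lra Lia.
From Coquelicot Require Import Coquelicot.
Open Scope R_scope.

(** * Functions whose derivatives alternate in sign *)

(* [u], [-u'], [u''], ..., up to order [n], are nonnegative on [D]. *)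
Fixpoint alternating (D : R -> Prop) (n : nat) (u : R -> R) : Prop :=
  (forall x, D x -> 0 <= u x) /\
  match n with
  | O => True
  | S n' => exists v, (forall x, D x -> is_derive u x (- v x)) /\ alternating D n' v
  end.

Lemma alternating_nonneg D n u x : alternating D n u -> D x -> 0 <= u x.
Proof. destruct n; intros [H _]; apply H. Qed.

Lemma alternating_pred D n u : alternating D (S n) u -> alternating D n u.
Proof.
  revert u; induction n as [|n IH]; intros u [Hu [v [Hv Av]]].
  - split; [exact Hu | exact I].
  - split; [exact Hu | exists v; split; [exact Hv | exact (IH v Av)]].
Qed.

Lemma alternating_ext D n u w : open D -> (forall x, D x -> u x = w x) ->
  alternating D n u -> alternating D n w.
Proof.
  intros oD E A.
  assert (Hw : forall x, D x -> 0 <= w x).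
  { intros x Dx. rewrite <- E by exact Dx. exact (alternating_nonneg D n u x A Dx). }
  destruct n as [|n]; (split; [exact Hw|]); [exact I|].
  destruct A as [_ [v [Hv Av]]]. exists v; split; [|exact Av].
  intros x Dx. apply is_derive_ext_loc with u; [|exact (Hv x Dx)].
  exact (filter_imp _ _ E (oD x Dx)).
Qed.

Lemma alternating_const D n c : 0 <= c -> alternating D n (fun _ => c).
Proof.
  revert c; induction n as [|n IH]; intros c c0; (split; [auto|]); [exact I|].
  exists (fun _ => 0); split; [|apply IH, Rle_refl].
  intros x _. rewrite Ropp_0. apply (is_derive_const c x).
Qed.

Lemma alternating_plus D n u w :
  alternating D n u -> alternating D n w -> alternating D n (fun x => u x + w x).
Proof.
  revert u w; induction n as [|n IH]; intros u w Au Aw.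
  all: split; [intros x Dx; apply Rplus_le_le_0_compat;
    eapply alternating_nonneg; eassumption|].
  - exact I.
  - destruct Au as [_ [u' [Hu Au]]], Aw as [_ [w' [Hw Aw]]].
    exists (fun x => u' x + w' x); split; [|exact (IH _ _ Au Aw)].
    intros x Dx. replace (- (u' x + w' x)) with (- u' x + - w' x) by ring.
    apply (is_derive_plus u w x); auto.
Qed.

(** By the product rule, the negated derivative is a sum of two products, each pairing one
    differentiated factor with one undifferentiated factor; [alternating_pred] lowers the order of
    the latter so that the induction applies. *)
Lemma alternating_mult D n u w :
  alternating D n u -> alternating D n w -> alternating D n (fun x => u x * w x).
Proof.
  revert u w; induction n as [|n IH]; intros u w Au Aw.
  all: split; [intros x Dx; apply Rmult_le_pos;
    eapply alternating_nonneg; eassumption|].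
  - exact I.
  - pose proof (alternating_pred _ _ _ Au) as Au0.
    pose proof (alternating_pred _ _ _ Aw) as Aw0.
    destruct Au as [_ [u' [Hu Au]]], Aw as [_ [w' [Hw Aw]]].
    exists (fun x => u' x * w x + u x * w' x); split.
    + intros x Dx.
      replace (- (u' x * w x + u x * w' x))
        with (- u' x * w x + u x * - w' x) by ring.
      apply (is_derive_mult u w x); [auto | auto | intros; apply Rmult_comm].
    + apply alternating_plus; apply IH; assumption.
Qed.

(** The negated derivative of [exp u] is [exp u] times that of [u], so each order follows from the
    previous one through [alternating_mult]. *)
Lemma alternating_exp D n u :
  alternating D n u -> alternating D n (fun x => exp (u x)).
Proof.
  induction n as [|n IH]; intros Au; (split; [intros; apply Rlt_le, exp_pos|]).
  - exact I.
  - pose proof (IH (alternating_pred _ _ _ Au)) as Ae.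
    destruct Au as [_ [v [Hv Av]]].
    exists (fun x => v x * exp (u x)); split; [|exact (alternating_mult _ _ _ _ Av Ae)].
    intros x Dx. replace (- (v x * exp (u x))) with (- v x * exp (u x)) by ring.
    apply (is_derive_comp exp u x); [apply is_derive_exp | auto].
Qed.

Lemma alternating_family D (A : nat -> R -> R) :
  (forall n x, D x -> 0 <= A n x) ->
  (forall n x, D x -> is_derive (A n) x (- A (S n) x)) ->
  forall n k, alternating D n (A k).
Proof.
  intros pos der n; induction n as [|n IH]; intros k; (split; [apply pos|]).
  - exact I.
  - exists (A (S k)); split; [apply der | apply IH].
Qed.

(** Passes from the chain of witnesses [v] to the total function [Derive_n]. Openness of [D] lets
    pointwise equalities on [D] be differentiated. *)
Lemma alternating_Derive_n D n u x : open D -> alternating D n u -> D x ->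
  ex_derive_n u n x /\ 0 <= (-1) ^ n * Derive_n u n x.
Proof.
  intros oD; revert u x; induction n as [|n IH]; intros u x Au Dx.
  - split; [exact I|]. simpl. rewrite Rmult_1_l.
    exact (alternating_nonneg _ _ _ _ Au Dx).
  - destruct Au as [_ [v [Hv Av]]].
    assert (E : forall j y, D y -> Derive_n u (S j) y = - Derive_n v j y).
    { intros j y Dy. replace (S j) with (j + 1)%nat by lia.
      rewrite <- (Derive_n_comp u j 1), <- Derive_n_opp.
      apply Derive_n_ext_loc.
      apply filter_imp with D; [|exact (oD y Dy)].
      intros z Dz. exact (is_derive_unique _ _ _ (Hv z Dz)). }
    split.
    + destruct n as [|n]; [exists (- v x); exact (Hv x Dx)|].
      apply ex_derive_ext_loc with (fun y => - Derive_n v n y).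
      * apply filter_imp with D; [|exact (oD x Dx)].
        intros y Dy. symmetry. exact (E n y Dy).
      * apply (ex_derive_opp (Derive_n v n)). exact (proj1 (IH v x Av Dx)).
    + rewrite (E n x Dx). destruct (IH v x Av Dx) as [_ H].
      simpl pow. nra.
Qed.

(** * Finite sums and limits at infinity *)

Lemma is_derive_sum_f_R0 (f df : nat -> R -> R) p x :
  (forall k, is_derive (f k) x (df k x)) ->
  is_derive (fun y => sum_f_R0 (fun k => f k y) p) x (sum_f_R0 (fun k => df k x) p).
Proof.
  intros H; induction p as [|p IH]; simpl; [apply H|].
  apply (is_derive_plus (fun y => sum_f_R0 (fun k => f k y) p) (f (S p)) x); auto.
Qed.

(** Stands in for positivity of an improper integral, [f] being the tail integral of [- df]: by the
    mean value theorem [f x <= f a] for large [x], and this passes to the limit. *)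
Lemma nonneg_of_decreasing_to_0 (f df : R -> R) a : 0 <= a ->
  (forall x, a <= x -> is_derive f x (df x)) ->
  (forall x, a <= x -> df x <= 0) ->
  is_lim f p_infty 0 -> 0 <= f a.
Proof.
  intros a0 der neg lim.
  destruct (Rle_or_lt 0 (f a)) as [H|H]; [exact H|exfalso].
  assert (Hle : Rbar_le 0 (f a)); [|simpl in Hle; lra].
  apply (is_lim_le_loc f (fun _ => f a) p_infty 0 (f a));
    [| exact lim | apply is_lim_const].
  exists a. intros x ax.
  destruct (MVT_gen f a x df) as [c [Hc E]].
  - intros y Hy. apply der. rewrite Rmin_left in Hy; lra.
  - intros y Hy. apply continuity_pt_filterlim.
    apply (ex_derive_continuous f). exists (df y). apply der.
    rewrite Rmin_left in Hy; lra.
  - rewrite Rmin_left in Hc by lra.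
    pose proof (neg c (proj1 Hc)). nra.
Qed.

Lemma is_lim_sum_f_R0 (f : nat -> R -> R) p :
  (forall k, is_lim (f k) p_infty 0) ->
  is_lim (fun y => sum_f_R0 (fun k => f k y) p) p_infty 0.
Proof.
  intros H; induction p as [|p IH]; simpl; [apply H|].
  replace (Finite 0) with (Rbar_plus 0 0) by (simpl; f_equal; ring).
  apply (is_lim_plus' _ (f (S p)) p_infty 0 0); auto.
Qed.

(** With b = a/(n+1), e^(as) = (e^(bs))^(n+1) >= (bs)^(n+1), so the product is at most a constant
    times 1/s. *)
Lemma is_lim_pow_mult_exp n a : 0 < a ->
  is_lim (fun s => s ^ n * exp (- (a * s))) p_infty 0.
Proof.
  intros a0.
  set (b := a / INR (S n)).
  assert (Sn0 : 0 < INR (S n)) by (apply lt_0_INR; lia).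
  assert (b0 : 0 < b) by (apply Rdiv_lt_0_compat; assumption).
  apply (is_lim_le_le_loc (fun _ => 0) (fun s => / b ^ S n * / s)).
  - exists 0. intros s s0. split.
    + apply Rmult_le_pos; [apply pow_le; lra | apply Rlt_le, exp_pos].
    + assert (E : exp (a * s) = exp (b * s) ^ S n).
      { rewrite <- Rpower_pow by apply exp_pos. unfold Rpower.
        rewrite ln_exp. f_equal. unfold b. field. lra. }
      assert (bs : 0 < b * s) by (apply Rmult_lt_0_compat; assumption).
      assert (H : (b * s) ^ S n <= exp (a * s)).
      { rewrite E. apply pow_incr. pose proof (exp_ineq1 (b * s)). lra. }
      rewrite exp_Ropp.
      assert (P : 0 < (b * s) ^ S n) by (apply pow_lt; assumption).
      assert (sn : 0 < s ^ n) by (apply pow_lt; assumption).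
      replace (/ b ^ S n * / s) with (s ^ n * / (b * s) ^ S n).
      * apply Rmult_le_compat_l; [lra|]. apply Rinv_le_contravar; assumption.
      * rewrite Rpow_mult_distr. simpl. field.
        repeat split; try lra. apply pow_nonzero; lra.
  - apply is_lim_const.
  - replace (Finite 0) with (Rbar_mult (/ b ^ S n) 0) by (simpl; f_equal; ring).
    apply (is_lim_scal_l Rinv (/ b ^ S n) p_infty 0).
    apply (is_lim_inv (fun x => x) p_infty p_infty); [apply is_lim_id | discriminate].
Qed.

(** * Tails of Laplace integrals of powers *)

(* [∫_s^∞ x^n e^(-a x) dx]. *)
Fixpoint gamma_tail (n : nat) (a s : R) : R :=
  match n with
  | O => exp (- (a * s)) / a
  | S n' => (s ^ n * exp (- (a * s)) + INR n * gamma_tail n' a s) / a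
  end.

(** The recursion is integration by parts: differentiating the boundary term yields the integrand
    plus a lower power, which the recursive term cancels. *)
Lemma is_derive_gamma_tail n a s : 0 < a ->
  is_derive (gamma_tail n a) s (- (s ^ n * exp (- (a * s)))).
Proof.
  intros a0; induction n as [|n IH].
  - simpl. auto_derive; [exact I|]. field. lra.
  - change (gamma_tail (S n) a) with
      (fun s => (s ^ S n * exp (- (a * s)) + INR (S n) * gamma_tail n a s) / a).
    assert (E : is_derive (fun s => s ^ S n * exp (- (a * s))) s
      (INR (S n) * s ^ n * exp (- (a * s)) - a * (s ^ S n * exp (- (a * s))))).
    { auto_derive; [exact I|]. rewrite S_INR. destruct n; simpl; ring. }
    pose proof (is_derive_plus _ _ _ _ _ E (is_derive_scal _ _ (INR (S n)) _ IH)) as H.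
    pose proof (is_derive_scal _ _ (/ a) _ H) as K.
    apply (is_derive_ext _ _ _ _ (fun y => Rmult_comm _ _)) in K.
    match type of K with is_derive _ _ ?l =>
      replace (- (s ^ S n * exp (- (a * s)))) with l; [exact K|] end.
    unfold plus, scal; simpl; unfold mult; simpl.
    field. lra.
Qed.

(** This is the full integral of x^n e^(-ax) over x > 0, and also (-1)^n times the n-th derivative
    of 1/a. *)
Definition inv_pow_fact (n : nat) (a : R) : R := INR (fact n) / a ^ S n.

Lemma gamma_tail_0 n a : 0 < a -> gamma_tail n a 0 = inv_pow_fact n a.
Proof.
  intros a0; unfold inv_pow_fact; induction n as [|n IH].
  - simpl. rewrite Rmult_0_r, Ropp_0, exp_0. field. lra.
  - change (gamma_tail (S n) a 0) with
      ((0 ^ S n * exp (- (a * 0)) + INR (S n) * gamma_tail n a 0) / a).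
    rewrite IH, fact_simpl, mult_INR. simpl pow. field.
    split; [|lra]. apply pow_nonzero; lra.
Qed.

Lemma is_lim_gamma_tail n a : 0 < a -> is_lim (gamma_tail n a) p_infty 0.
Proof.
  intros a0; induction n as [|n IH].
  - apply is_lim_ext with (fun s => / a * (s ^ 0 * exp (- (a * s)))).
    { intros s. simpl. field. lra. }
    replace (Finite 0) with (Rbar_mult (/ a) 0) by (simpl; f_equal; ring).
    apply is_lim_scal_l. apply is_lim_pow_mult_exp, a0.
  - apply is_lim_ext with
      (fun s => / a * (s ^ S n * exp (- (a * s)) + INR (S n) * gamma_tail n a s)).
    { intros s. change (gamma_tail (S n) a s) with
        ((s ^ S n * exp (- (a * s)) + INR (S n) * gamma_tail n a s) / a).
      field. lra. }
    replace (Finite 0) with (Rbar_mult (/ a) (0 + INR (S n) * 0))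
      by (simpl; f_equal; ring).
    apply is_lim_scal_l. apply is_lim_plus'; [apply is_lim_pow_mult_exp, a0|].
    replace (Finite (INR (S n) * 0)) with (Rbar_mult (INR (S n)) 0) by reflexivity.
    apply is_lim_scal_l, IH.
Qed.

(** * Positivity of the Laplace kernel *)

Lemma sum_f_R0_id_pow r p :
  (1 - r) ^ 2 * sum_f_R0 (fun k => INR k * r ^ k) p =
  r * (1 - r ^ S p) - INR (S p) * r ^ S p * (1 - r).
Proof.
  induction p as [|p IH]; [simpl; ring|].
  rewrite tech5, Rmult_plus_distr_l, IH, !S_INR. simpl pow. ring.
Qed.

Lemma exp_opp_ge s : 1 - s <= exp (- s).
Proof. pose proof (exp_ineq1_le (- s)). lra. Qed.

(* Equivalent to [s / 2 <= sinh (s / 2)]. *)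
Lemma sqr_mult_exp_opp_le s : 0 <= s -> s ^ 2 * exp (- s) <= (1 - exp (- s)) ^ 2.
Proof.
  intros s0.
  (* This is the square root of the claim. The difference of the two sides vanishes at 0, and its
     derivative [df] is nonnegative because e^(-x/2) >= 1 - x/2. *)
  assert (H : s * exp (- (s / 2)) <= 1 - exp (- s)).
  { set (f := fun x => 1 - exp (- x) - x * exp (- (x / 2))).
    set (df := fun x => exp (- (x / 2)) * (exp (- (x / 2)) - (1 - x / 2))).
    destruct (MVT_gen f 0 s df) as [c [Hc E]].
    - intros x _. unfold f, df. auto_derive; [exact I|].
      change (x * / 2) with (x / 2).
      replace (- x) with (- (x / 2) + - (x / 2)) by field.
      rewrite exp_plus. field.
    - intros x _. apply continuity_pt_filterlim.
      apply (ex_derive_continuous f). unfold f. auto_derive. exact I.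
    - rewrite Rmin_left in Hc by lra.
      assert (0 <= df c).
      { apply Rmult_le_pos; [apply Rlt_le, exp_pos|].
        pose proof (exp_opp_ge (c / 2)). lra. }
      assert (0 <= df c * (s - 0)) by (apply Rmult_le_pos; lra).
      assert (f 0 = 0).
      { unfold f. rewrite Ropp_0, exp_0. ring. }
      unfold f in *. lra. }
  replace (s ^ 2 * exp (- s)) with ((s * exp (- (s / 2))) ^ 2).
  - apply pow_incr. split; [|exact H].
    apply Rmult_le_pos; [exact s0 | apply Rlt_le, exp_pos].
  - replace (- s) with (- (s / 2) + - (s / 2)) by field.
    rewrite exp_plus. ring.
Qed.

(* After multiplication by [(1 - e^(-s))^2] the right-hand side becomes a
   nonnegative combination of [(1 - e^(-s))^2 - s^2 e^(-s)] and
   [s - (1 - e^(-s))]. *)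
Lemma laplace_kernel_nonneg p s : 0 <= s ->
  0 <= 1 - exp (- (INR (S p) * s)) - INR (S p) * (s * exp (- (INR (S p) * s)))
       - s ^ 2 * sum_f_R0 (fun k => INR k * exp (- (INR k * s))) p.
Proof.
  intros s0.
  assert (Er : forall k, exp (- (INR k * s)) = exp (- s) ^ k).
  { intros k. rewrite <- Rpower_pow by apply exp_pos.
    unfold Rpower. rewrite ln_exp. f_equal. ring. }
  rewrite Er.
  rewrite (sum_eq _ (fun k => INR k * exp (- s) ^ k)) by (intros; rewrite Er; reflexivity).
  (* At s = 0 the multiplier (1 - e^(-s))^2 vanishes and cannot be cancelled, so this case is
     computed directly. *)
  destruct s0 as [s0|<-].
  2:{ rewrite Ropp_0, exp_0, pow1. simpl pow. lra. }
  pose proof (sqr_mult_exp_opp_le s (Rlt_le _ _ s0)) as H1.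
  pose proof (exp_opp_ge s) as H2.
  pose proof (exp_pos (- s)) as H3.
  assert (H4 : exp (- s) < 1) by (rewrite <- exp_0; apply exp_increasing; lra).
  set (r := exp (- s)) in *.
  pose proof (sum_f_R0_id_pow r p) as Hs.
  set (Sg := sum_f_R0 _ p) in *.
  assert (Hm : 0 < INR (S p)) by (apply lt_0_INR; lia).
  assert (P : 0 < r ^ S p) by (apply pow_lt; exact H3).
  assert (P1 : r ^ S p <= 1) by (rewrite <- (pow1 (S p)); apply pow_incr; lra).
  set (m := INR (S p)) in *. set (P0 := r ^ S p) in *. clearbody m P0.
  assert (Q : 0 < (1 - r) ^ 2) by (apply pow_lt; lra).
  apply Rmult_le_reg_l with ((1 - r) ^ 2); [exact Q|].
  replace ((1 - r) ^ 2 * (1 - P0 - m * (s * P0) - s ^ 2 * Sg))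
    with ((1 - P0) * ((1 - r) ^ 2 - s ^ 2 * r)
          + m * P0 * (1 - r) * s * (s - (1 - r))).
  - rewrite Rmult_0_r. apply Rplus_le_le_0_compat.
    + apply Rmult_le_pos; lra.
    + repeat apply Rmult_le_pos; lra.
  - replace ((1 - r) ^ 2 * (1 - P0 - m * (s * P0) - s ^ 2 * Sg))
      with ((1 - r) ^ 2 * (1 - P0 - m * (s * P0)) - s ^ 2 * ((1 - r) ^ 2 * Sg)) by ring.
    rewrite Hs. ring.
Qed.

(** * Inverse powers and the integrated kernel inequality *)

Lemma is_derive_inv_pow_fact n a : 0 < a ->
  is_derive (inv_pow_fact n) a (- inv_pow_fact (S n) a).
Proof.
  intros a0. unfold inv_pow_fact.
  assert (a ^ S n <> 0) by (apply pow_nonzero; lra).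
  assert (a ^ n <> 0) by (apply pow_nonzero; lra).
  auto_derive; [exact H|].
  change (match n with O => 1 | S _ => INR n + 1 end) with (INR (S n)).
  rewrite fact_simpl, mult_INR. simpl pow.
  field. split; [assumption|lra].
Qed.

Lemma inv_pow_fact_S n a : 0 < a ->
  a * inv_pow_fact (S n) a = INR (S n) * inv_pow_fact n a.
Proof.
  intros a0. unfold inv_pow_fact. rewrite fact_simpl, mult_INR. simpl pow.
  field. split; [|lra]. apply pow_nonzero; lra.
Qed.

Lemma inv_pow_fact_nonneg n a : 0 < a -> 0 <= inv_pow_fact n a.
Proof.
  intros a0. apply Rlt_le, Rdiv_lt_0_compat; [apply lt_0_INR, lt_O_fact | apply pow_lt, a0].
Qed.

(** The expression is the integral over s > 0 of s^n e^(-ts) times the kernel of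
    [laplace_kernel_nonneg]. In the proof [F] is the tail of this integral, so its value at 0 is the
    expression, it is nonincreasing, and it tends to 0. *)
Lemma inv_pow_fact_sum_le n p t : 0 < t ->
  0 <= inv_pow_fact n t - inv_pow_fact n (t + INR (S p))
       - INR (S p) * inv_pow_fact (S n) (t + INR (S p))
       - sum_f_R0 (fun k => INR k * inv_pow_fact (S (S n)) (t + INR k)) p.
Proof.
  intros t0.
  assert (pos : forall k, 0 < t + INR k) by (intros k; pose proof (pos_INR k); lra).
  set (m := INR (S p)).
  set (F := fun s => gamma_tail n t s - gamma_tail n (t + m) s
       - m * gamma_tail (S n) (t + m) s
       - sum_f_R0 (fun k => INR k * gamma_tail (S (S n)) (t + INR k) s) p).
  set (K := fun s => 1 - exp (- (m * s)) - m * (s * exp (- (m * s)))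
       - s ^ 2 * sum_f_R0 (fun k => INR k * exp (- (INR k * s))) p).
  assert (E : F 0 = inv_pow_fact n t - inv_pow_fact n (t + m)
       - m * inv_pow_fact (S n) (t + m)
       - sum_f_R0 (fun k => INR k * inv_pow_fact (S (S n)) (t + INR k)) p).
  { unfold F, m. rewrite !gamma_tail_0 by auto. f_equal. apply sum_eq.
    intros k _. rewrite gamma_tail_0 by auto. reflexivity. }
  rewrite <- E.
  apply nonneg_of_decreasing_to_0 with (fun s => - (s ^ n * exp (- (t * s)) * K s)).
  - lra.
  - intros s s0. unfold F.
    pose proof (is_derive_gamma_tail n t s t0) as D1.
    pose proof (is_derive_gamma_tail n (t + m) s (pos _)) as D2.
    pose proof (is_derive_scal _ _ m _ (is_derive_gamma_tail (S n) (t + m) s (pos _))) as D3.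
    pose proof (is_derive_sum_f_R0
      (fun k s => INR k * gamma_tail (S (S n)) (t + INR k) s)
      (fun k s => INR k * - (s ^ S (S n) * exp (- ((t + INR k) * s)))) p s
      (fun k => is_derive_scal _ _ (INR k) _
         (is_derive_gamma_tail (S (S n)) (t + INR k) s (pos k)))) as D4.
    pose proof (is_derive_minus _ _ _ _ _
      (is_derive_minus _ _ _ _ _ (is_derive_minus _ _ _ _ _ D1 D2) D3) D4) as H.
    match type of H with is_derive _ _ ?l => replace (- (s ^ n * exp (- (t * s)) * K s))
      with l; [exact H|] end.
    unfold minus, plus, opp; simpl.
    (* Splitting the exponentials exposes the common factor s^n e^(-ts); the remaining factor is the
       kernel [K]. *)
    assert (Es : forall a, exp (- ((t + a) * s)) = exp (- (t * s)) * exp (- (a * s))).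
    { intros a. rewrite <- exp_plus. f_equal. ring. }
    rewrite Es. unfold K.
    replace (sum_f_R0 (fun k => INR k * - (s * (s * s ^ n) * exp (- ((t + INR k) * s)))) p)
      with (- (s * (s * s ^ n) * exp (- (t * s)))
            * sum_f_R0 (fun k => INR k * exp (- (INR k * s))) p).
    + ring.
    + rewrite scal_sum. apply sum_eq. intros k _. rewrite Es. ring.
  - intros s s0. pose proof (laplace_kernel_nonneg p s s0) as Hk.
    change (0 <= K s) in Hk.
    assert (0 <= s ^ n * exp (- (t * s)) * K s); [|lra].
    repeat apply Rmult_le_pos; [apply pow_le, s0 | apply Rlt_le, exp_pos | exact Hk].
  - replace (Finite 0) with (Finite (0 - 0 - m * 0 - 0)) by (f_equal; ring).
    unfold F.
    apply is_lim_minus'; [apply is_lim_minus'; [apply is_lim_minus'|]|].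
    + apply is_lim_gamma_tail, t0.
    + apply is_lim_gamma_tail, pos.
    + apply (is_lim_scal_l (gamma_tail (S n) (t + m)) m p_infty 0).
      apply is_lim_gamma_tail, pos.
    + apply (is_lim_sum_f_R0 (fun k s => INR k * gamma_tail (S (S n)) (t + INR k) s)).
      intros k. replace (Finite 0) with (Rbar_mult (INR k) 0) by (simpl; f_equal; ring).
      apply is_lim_scal_l, is_lim_gamma_tail, pos.
Qed.

(** * The functions f and g and their signed derivatives *)

(* [(-1)^n] times the n-th derivative of [f]; [scaled_gap] is the analogue for [g]. *)
Definition digamma_gap (p n : nat) (t : R) : R :=
  match n with
  | O => sum_f_R0 (fun k => inv_pow_fact 0 (t + INR k)) p
         - (ln (t + INR (S p)) - ln t)
  | S n' => sum_f_R0 (fun k => inv_pow_fact n (t + INR k)) p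
         - (inv_pow_fact n' t - inv_pow_fact n' (t + INR (S p)))
  end.

Lemma is_derive_digamma_gap p n t : 0 < t ->
  is_derive (digamma_gap p n) t (- digamma_gap p (S n) t).
Proof.
  intros t0.
  assert (pos : forall k, 0 < t + INR k) by (intros k; pose proof (pos_INR k); lra).
  assert (Dsh : forall j a, 0 < t + a ->
    is_derive (fun t => inv_pow_fact j (t + a)) t (- inv_pow_fact (S j) (t + a))).
  { intros j a ta.
    rewrite <- (Rmult_1_l (- _)).
    apply (is_derive_comp (inv_pow_fact j) (fun t => t + a) t);
      [apply is_derive_inv_pow_fact, ta | auto_derive; [exact I | ring]]. }
  assert (Ds := is_derive_sum_f_R0 (fun k t => inv_pow_fact n (t + INR k))
    (fun k t => - inv_pow_fact (S n) (t + INR k)) p t (fun k => Dsh n (INR k) (pos k))).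
  assert (Es : sum_f_R0 (fun k => - inv_pow_fact (S n) (t + INR k)) p
    = - sum_f_R0 (fun k => inv_pow_fact (S n) (t + INR k)) p).
  { replace (- sum_f_R0 (fun k => inv_pow_fact (S n) (t + INR k)) p)
      with (-1 * sum_f_R0 (fun k => inv_pow_fact (S n) (t + INR k)) p) by ring.
    rewrite scal_sum. apply sum_eq. intros; ring. }
  cbv beta in Ds. rewrite Es in Ds.
  (* Only order 0 contains logarithms; from order 1 on every term is an inverse power. *)
  destruct n as [|n].
  - assert (Dl : is_derive (fun t => ln (t + INR (S p)) - ln t) t
      (inv_pow_fact 0 (t + INR (S p)) - inv_pow_fact 0 t)).
    { pose proof (pos (S p)) as ps. unfold inv_pow_fact.
      auto_derive; [split; [exact ps|split; [exact t0|exact I]]|].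
      change (match p with O => 1 | S _ => INR p + 1 end) with (INR (S p)).
      change (INR (fact 0)) with 1. field. split; lra. }
    pose proof (is_derive_minus _ _ _ _ _ Ds Dl) as H.
    unfold digamma_gap.
    match type of H with is_derive _ _ ?l =>
      match goal with |- is_derive _ _ ?r => replace r with l; [exact H|] end end.
    unfold minus, plus, opp; simpl. ring.
  - pose proof (is_derive_minus _ _ _ _ _ Ds (is_derive_minus _ _ _ _ _
      (is_derive_inv_pow_fact n t t0) (Dsh n _ (pos (S p))))) as H.
    unfold digamma_gap at 1.
    match type of H with is_derive _ _ ?l =>
      match goal with |- is_derive _ _ ?r => replace r with l; [exact H|] end end.
    unfold digamma_gap, minus, plus, opp; simpl. ring.
Qed.

(** This is the Leibniz rule for t f(t) with the sign (-1)^n absorbed. At n = 0 [pred n] is again 0,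
    but its coefficient vanishes. *)
Definition scaled_gap (p n : nat) (t : R) : R :=
  t * digamma_gap p n t - INR n * digamma_gap p (pred n) t.

Lemma is_derive_scaled_gap p n t : 0 < t ->
  is_derive (scaled_gap p n) t (- scaled_gap p (S n) t).
Proof.
  intros t0.
  assert (D1 : is_derive (fun t => t * digamma_gap p n t) t
    (digamma_gap p n t - t * digamma_gap p (S n) t)).
  { replace (digamma_gap p n t - t * digamma_gap p (S n) t)
      with (1 * digamma_gap p n t + t * - digamma_gap p (S n) t) by ring.
    apply (is_derive_mult (fun t => t) (digamma_gap p n) t);
      [apply (is_derive_id t) | apply is_derive_digamma_gap, t0
      | intros; apply Rmult_comm]. }
  assert (D2 : is_derive (fun t => INR n * digamma_gap p (pred n) t) t
    (- (INR n * digamma_gap p n t))).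
  { destruct n as [|n].
    - apply is_derive_ext with (fun _ => 0); [intros; simpl; ring|].
      replace (- _) with 0 by (simpl; ring). apply (is_derive_const 0 t).
    - rewrite Ropp_mult_distr_r.
      apply (is_derive_scal (digamma_gap p n)). apply is_derive_digamma_gap, t0. }
  pose proof (is_derive_minus _ _ _ _ _ D1 D2) as H.
  unfold scaled_gap at 1.
  match type of H with is_derive _ _ ?l =>
    match goal with |- is_derive _ _ ?r => replace r with l; [exact H|] end end.
  unfold scaled_gap, minus, plus, opp; rewrite S_INR; simpl. ring.
Qed.

(** * Complete monotonicity of g *)

(** Write t = (t + k) - k in each term; the factor t + k lowers the exponent by [inv_pow_fact_S]. *)
Lemma mult_inv_pow_fact_sum n p t : 0 < t ->
  t * sum_f_R0 (fun k => inv_pow_fact (S n) (t + INR k)) p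
  = INR (S n) * sum_f_R0 (fun k => inv_pow_fact n (t + INR k)) p
    - sum_f_R0 (fun k => INR k * inv_pow_fact (S n) (t + INR k)) p.
Proof.
  intros t0. rewrite !scal_sum, <- minus_sum. apply sum_eq. intros k _.
  assert (0 < t + INR k) by (pose proof (pos_INR k); lra).
  pose proof (inv_pow_fact_S n (t + INR k) H). lra.
Qed.

(** Absorbing the factor t into the inverse powers cancels the unweighted sums; what remains is
    exactly the expression of [inv_pow_fact_sum_le]. *)
Lemma scaled_gap_SS_nonneg p n t : 0 < t -> 0 <= scaled_gap p (S (S n)) t.
Proof.
  intros t0. pose proof (inv_pow_fact_sum_le n p t t0) as H.
  pose proof (mult_inv_pow_fact_sum (S n) p t t0) as H1.
  pose proof (inv_pow_fact_S n t t0) as H2.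
  assert (c0 : 0 < t + INR (S p)) by (pose proof (pos_INR (S p)); lra).
  pose proof (inv_pow_fact_S n _ c0) as H3.
  unfold scaled_gap, digamma_gap, pred.
  set (m := INR (S p)) in *.
  rewrite (S_INR (S n)) in *. set (j := INR (S n)) in *.
  nra.
Qed.

Lemma ln_add_sub_le t m : 0 < t -> 0 <= m -> 0 <= ln (t + m) - ln t <= m / t.
Proof.
  intros t0 m0.
  assert (E : ln (t + m) - ln t = ln (1 + m / t)).
  { rewrite <- ln_div by lra. f_equal. field. lra. }
  assert (0 <= m / t) by (apply Rdiv_le_0_compat; lra).
  split.
  - rewrite E, <- ln_1. apply ln_le; lra.
  - rewrite E. rewrite <- (ln_exp (m / t)) at 2.
    apply ln_le; [lra | apply exp_ineq1_le].
Qed.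

(** The logarithm telescopes into ln (t+k+1) - ln (t+k), each at most 1/(t+k). *)
Lemma digamma_gap_0_nonneg p t : 0 < t -> 0 <= digamma_gap p 0 t.
Proof.
  intros t0. unfold digamma_gap. induction p as [|p IH].
  - pose proof (ln_add_sub_le t 1 t0 Rle_0_1). unfold inv_pow_fact. simpl in *.
    rewrite Rplus_0_r, Rmult_1_r. unfold Rdiv in *. lra.
  - rewrite tech5.
    assert (c0 : 0 < t + INR (S p)) by (pose proof (pos_INR (S p)); lra).
    pose proof (ln_add_sub_le _ 1 c0 Rle_0_1) as H.
    rewrite (S_INR (S p)). unfold inv_pow_fact at 2. simpl fact.
    rewrite pow_1. replace (t + (INR (S p) + 1)) with (t + INR (S p) + 1) by ring.
    simpl (INR 1). lra.
Qed.

Lemma is_lim_inv_shift a : is_lim (fun t => / (t + a)) p_infty 0.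
Proof.
  apply (is_lim_inv (fun t => t + a) p_infty p_infty); [|discriminate].
  eapply is_lim_plus; [apply is_lim_id | apply is_lim_const | reflexivity].
Qed.

Lemma is_lim_scaled_gap_1 p : is_lim (scaled_gap p 1) p_infty 0.
Proof.
  set (m := INR (S p)).
  assert (m0 : 0 <= m) by apply pos_INR.
  (* The sums of 1/(t+k) cancel, and -1 + t/(t+m) gives -m/(t+m); every remaining term tends to 0
     separately. *)
  apply is_lim_ext_loc with (fun t => (ln (t + m) - ln t) - m * / (t + m)
    - sum_f_R0 (fun k => INR k * (/ (t + INR k) * / (t + INR k))) p).
  - exists 0. intros t t0. unfold scaled_gap, digamma_gap, pred.
    rewrite Rmult_minus_distr_l, (mult_inv_pow_fact_sum 0 p t t0).
    rewrite (sum_eq (fun k => INR k * inv_pow_fact 1 (t + INR k))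
      (fun k => INR k * (/ (t + INR k) * / (t + INR k)))).
    + fold m. unfold inv_pow_fact. simpl. field. lra.
    + intros k _. pose proof (pos_INR k). unfold inv_pow_fact. simpl. field. lra.
  - replace (Finite 0) with (Finite (0 - m * 0 - 0)) by (f_equal; ring).
    apply is_lim_minus'; [apply is_lim_minus'|].
    + apply (is_lim_le_le_loc (fun _ => 0) (fun t => m * / (t + 0))).
      * exists 0. intros t t0. rewrite Rplus_0_r. apply ln_add_sub_le; assumption.
      * apply is_lim_const.
      * replace (Finite 0) with (Rbar_mult m 0) by (simpl; f_equal; ring).
        apply is_lim_scal_l, is_lim_inv_shift.
    + apply (is_lim_scal_l (fun t => / (t + m)) m p_infty 0), is_lim_inv_shift.
    + apply (is_lim_sum_f_R0 (fun k t => INR k * (/ (t + INR k) * / (t + INR k)))).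
      intros k. replace (Finite 0) with (Rbar_mult (INR k) (Rbar_mult 0 0))
        by (simpl; f_equal; ring).
      apply is_lim_scal_l, is_lim_mult; [apply is_lim_inv_shift.. | exact I].
Qed.

Lemma scaled_gap_nonneg p n t : 0 < t -> 0 <= scaled_gap p n t.
Proof.
  intros t0. destruct n as [|[|n]].
  - unfold scaled_gap. simpl INR. rewrite Rmult_0_l, Rminus_0_r.
    apply Rmult_le_pos; [lra | apply digamma_gap_0_nonneg, t0].
  (* Order 1 would call for the weight s^(-1), which [gamma_tail] does not cover; the sign at order
     2 gives monotonicity instead. *)
  - apply nonneg_of_decreasing_to_0 with (fun x => - scaled_gap p 2 x).
    + lra.
    + intros x tx. apply is_derive_scaled_gap. lra.
    + intros x tx. pose proof (scaled_gap_SS_nonneg p 0 x). lra.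
    + apply is_lim_scaled_gap_1.
  - apply scaled_gap_SS_nonneg, t0.
Qed.

(** * Closed form of the p-digamma function and sign of Euler's constant *)

Lemma p_digamma_eq p t : (0 < p)%nat -> 0 < t ->
  p_digamma p t = ln (INR p) - sum_f_R0 (fun k => / (t + INR k)) p.
Proof.
  intros hp t0. unfold p_digamma.
  assert (p0 : 0 < INR p) by (apply lt_0_INR; exact hp).
  assert (Hprod : forall j y, 0 < y -> 0 < prod_f_R0 (fun k => y + INR k) j /\
    ln (prod_f_R0 (fun k => y + INR k) j) = sum_f_R0 (fun k => ln (y + INR k)) j).
  { intros j y y0. induction j as [|j [IH1 IH2]]; simpl prod_f_R0; simpl sum_f_R0.
    - split; [simpl; lra | reflexivity].
    - assert (0 < y + INR (S j)) by (pose proof (pos_INR (S j)); lra).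
      split; [apply Rmult_lt_0_compat; assumption|].
      rewrite ln_mult by assumption. rewrite IH2. reflexivity. }
  apply is_derive_unique.
  (* The logarithm of the product expands into a sum for y > 0, hence near t. *)
  apply is_derive_ext_loc with (fun y => ln (INR (fact p)) + y * ln (INR p)
     - sum_f_R0 (fun k => ln (y + INR k)) p).
  - apply filter_imp with (fun y => 0 < y); [|exact (open_gt 0 t t0)].
    intros y y0. destruct (Hprod p y y0) as [P1 P2].
    assert (f0 : 0 < INR (fact p)) by (apply lt_0_INR, lt_O_fact).
    unfold p_gamma. rewrite ln_div, ln_mult, P2; try assumption.
    + unfold Rpower. rewrite ln_exp. reflexivity.
    + apply exp_pos.
    + apply Rmult_lt_0_compat; [exact f0 | apply exp_pos].
  - apply (is_derive_minus (fun y => ln (INR (fact p)) + y * ln (INR p))).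
    + auto_derive; [exact I | ring].
    + apply (is_derive_sum_f_R0 (fun k y => ln (y + INR k)) (fun k y => / (y + INR k))).
      intros k. pose proof (pos_INR k). auto_derive; [lra | field; lra].
Qed.

Lemma euler_mascheroni_nonneg : 0 <= euler_mascheroni.
Proof.
  unfold euler_mascheroni.
  (* The induction starts from the empty sum and ln 1 = 0; each step uses ln (n+2) - ln (n+1) <=
     1/(n+1). *)
  assert (H : forall n, ln (INR (S n)) <= sum_n_m (fun k => / INR k) 1 n).
  { induction n as [|n IH].
    - rewrite sum_n_m_zero by lia. simpl INR. rewrite ln_1. apply Rle_refl.
    - rewrite sum_n_Sm by lia.
      assert (n0 : 0 < INR (S n)) by (apply lt_0_INR; lia).
      pose proof (ln_add_sub_le _ 1 n0 Rle_0_1).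
      match goal with |- _ <= plus ?a ?b => change (plus a b) with (a + b) end.
      rewrite (S_INR (S n)). unfold Rdiv in *. lra. }
  assert (L : Rbar_le (Lim_seq (fun _ => 0))
    (Lim_seq (fun n => sum_n_m (fun k => / INR k) 1 n - ln (INR n)))).
  { apply Lim_seq_le_loc. exists 1%nat. intros n n1.
    assert (n0 : 0 < INR n) by (apply lt_0_INR; lia).
    pose proof (H n). assert (ln (INR n) <= ln (INR (S n))); [|lra].
    apply ln_le; [exact n0 | rewrite S_INR; lra]. }
  rewrite Lim_seq_const in L.
  (* [Lim_seq] is an extended real; on infinite values [real] returns 0, which is also
     nonnegative. *)
  destruct (Lim_seq _); simpl in *; [exact L | apply Rle_refl | apply Rle_refl].
Qed.

(** * Logarithmic complete monotonicity of [q_fun] *)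

(** The bound x < 1 enters here, making - ln x nonnegative; its signed derivatives i!/x^(i+1) are
    nonnegative for every x > 0. *)
Lemma alternating_opp_ln n : alternating (fun x => 0 < x < 1) n (fun x => - ln x).
Proof.
  apply (alternating_family _ (fun j =>
    match j with O => fun x => - ln x | S i => inv_pow_fact i end)) with (k := O).
  - intros [|j] x [x0 x1]; [|exact (inv_pow_fact_nonneg j x x0)].
    pose proof (ln_increasing x 1 x0 x1) as H. rewrite ln_1 in H. lra.
  - intros [|j] x [x0 x1]; [|exact (is_derive_inv_pow_fact j x x0)].
    unfold inv_pow_fact. auto_derive; [exact x0|]. simpl. field. lra.
Qed.

(** In the exponent ln p cancels, leaving -(gamma + g(t)); the minus sign is moved onto ln t. *)
Lemma q_fun_eq p t : (0 < p)%nat -> 0 < t ->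
  q_fun p t = exp ((euler_mascheroni + scaled_gap p 0 t) * - ln t).
Proof.
  intros hp t0. unfold q_fun, Rpower. f_equal.
  assert (p0 : 0 < INR p) by (apply lt_0_INR; exact hp).
  rewrite (p_digamma_eq p t hp t0).
  rewrite ln_div, ln_mult; try nra.
  unfold scaled_gap, digamma_gap.
  rewrite (sum_eq (fun k => inv_pow_fact 0 (t + INR k)) (fun k => / (t + INR k))).
  - rewrite (S_INR p), <- Rplus_assoc. simpl (INR 0). ring.
  - intros k _. pose proof (pos_INR k). unfold inv_pow_fact. simpl. field. lra.
Qed.

Theorem theorem2p3 (p : nat) (hp : (0 < p)%nat) :
  log_completely_monotonic_on (Finite 0) (Finite 1) (q_fun p).
Proof.
  intros x x0 x1. simpl in x0, x1.
  set (D := fun x => 0 < x < 1).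
  assert (Dx : D x) by (split; assumption).
  assert (oD : open D) by (apply open_and; [apply open_gt | apply open_lt]).
  assert (Au : forall n, alternating D n
    (fun t => (euler_mascheroni + scaled_gap p 0 t) * - ln t)).
  { intros n. apply alternating_mult; [|apply alternating_opp_ln].
    apply alternating_plus; [apply alternating_const, euler_mascheroni_nonneg|].
    apply (alternating_family D (scaled_gap p)).
    - intros j t [t0 _]. apply scaled_gap_nonneg, t0.
    - intros j t [t0 _]. apply is_derive_scaled_gap, t0. }
  assert (Eq : forall t, D t ->
    exp ((euler_mascheroni + scaled_gap p 0 t) * - ln t) = q_fun p t).
  { intros t [t0 _]. symmetry. apply q_fun_eq; assumption. }
  split; [|split].
  - rewrite <- Eq by exact Dx. apply exp_pos.
  (* Smoothness of [q_fun] itself comes from closure under exponentials; the sign condition below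
     needs only the exponent. *)
  - intros n. apply (alternating_Derive_n D n (q_fun p) x oD); [|exact Dx].
    apply (alternating_ext D n _ _ oD Eq), alternating_exp, Au.
  - intros n _. apply (alternating_Derive_n D n _ x oD); [|exact Dx].
    refine (alternating_ext D n _ _ oD _ (Au n)).
    intros t Dt. rewrite <- Eq by exact Dt. symmetry. apply ln_exp.
Qed.
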